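(* Suppose $X$ has neither a maximum nor a minimum. Let $Y$ be a nonempty proper convex subset of $X$. If $Y$ has a minimum or a maximum, then $\operatorname{rank}(\mathcal{OP}(X,Y):\mathcal{O}(X,Y))=1$.
   Context: Maps are written on the right of their arguments and composed from left to right. Throughout, $X$ is an infinite linearly ordered set that is dense (for all $x<y$ in $X$ there is $z\in X$ with $x<z<y$). A subset $C\subseteq X$ is convex if $x,y\in C$, $z\in X$ and $x<z<y$ imply $z\in C$; an open convex subset of $X$ is a nonempty convex subset of $X$ having neither a minimum nor a maximum. For sets, $A<B$ means $a<b$ for all $a\in A$, $b\in B$. It is assumed that $X$ satisfies: (a) if $X=X'\cup X''$ with $X'<X''$ and $X',X''\neq\emptyset$, then $X'$ has a maximum or $X''$ has a minimum; (b) any two open convex subsets of $X$ are order-isomorphic (i.e., there is an order-preserving bijection between them). $\mathcal{T}(X)$ is the monoid of all maps $X\to X$ under composition, and $\mathcal{O}(X)$ is its submonoid of order-preserving maps ($x\le y$ implies $x\alpha\le y\alpha$). A map $\alpha\in\mathcal{T}(X)$ is orientation-preserving if there is a nonempty subset $X_1\subseteq X$ such that, with $X_2=X\setminus X_1$: (1) $\alpha$ is order-preserving on $X_1$ and on $X_2$; and (2) for all $p\in X_1$ and $q\in X_2$, $p<q$ and $p\alpha\ge q\alpha$. $\mathcal{OP}(X)$ is the monoid of all orientation-preserving maps on $X$. For a nonempty $Y\subseteq X$, $\mathcal{O}(X,Y)=\{\alpha\in\mathcal{O}(X):\operatorname{im}\alpha\subseteq Y\}$ and $\mathcal{OP}(X,Y)=\{\alpha\in\mathcal{OP}(X):\operatorname{im}\alpha\subseteq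 Y\}$; these are semigroups with $\mathcal{O}(X,Y)\subseteq\mathcal{OP}(X,Y)$. For a semigroup $S$ and $A\subseteq S$, the relative rank $\operatorname{rank}(S:A)$ is the minimal cardinality of a set $B\subseteq S$ such that $A\cup B$ generates $S$.
   Formalization: The set Y is additionally assumed to have at least two points, because for a singleton Y the semigroups OP(X,Y) and O(X,Y) coincide and the relative rank is 0 rather than 1. *)

(* Defs.v *)
From HB Require Import structures.
From mathcomp Require Import all_boot all_order.
From mathcomp Require Import boolp classical_sets functions cardinality.

Set Implicit Arguments.
Unset Strict Implicit.
Unset Printing Implicit Defensive.

Local Open Scope order_scope.
Local Open Scope classical_set_scope.
Local Open Scope card_scope.

Section LinearOrder.
Context {d : Order.disp_t} {X : orderType d}.
Implicit Types A B C : set X.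

Definition has_max A := A `&` ubound A !=set0.

Definition has_min A := A `&` lbound A !=set0.

Definition convex C := forall x y z, C x -> C y -> x < z -> z < y -> C z.

Definition open_convex C :=
  [/\ C !=set0, convex C, ~ has_max C & ~ has_min C].

Definition set_lt A B := forall a b, A a -> B b -> a < b.

(* A and B are compared as ordered subsets: f matters only on A. *)
Definition order_isomorphic A B :=
  exists f : X -> X, set_bij A B f /\ {in A &, {homo f : x y / x <= y}}.

End LinearOrder.

(* Arguments are explicit: these are conditions on the whole order X. *)
Definition dense_order (d : Order.disp_t) (X : orderType d) :=
  forall x y : X, x < y -> exists z, x < z /\ z < y.

Definition cuts_filled (d : Order.disp_t) (X : orderType d) :=
  forall A B : set X, [set: X] = A `|` B -> set_lt A B ->
    A !=set0 -> B !=set0 -> has_max A \/ has_min B.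

Definition open_convex_isomorphic (d : Order.disp_t) (X : orderType d) :=
  forall A B : set X, open_convex A -> open_convex B -> order_isomorphic A B.

Definition transf (X : Type) : Type := X -> X.

HB.instance Definition _ (X : Type) := gen_eqMixin (transf X).
HB.instance Definition _ (X : Type) := gen_choiceMixin (transf X).

Section TransfMonoid.
Variable X : Type.
Implicit Types f g h : transf X.

(* Maps act on the right, so f * g is "first f, then g". *)
Definition transf_mul f g : transf X := fun x => g (f x).

Definition transf_one : transf X := id.

Fact transf_mulA : associative transf_mul. Proof. by []. Qed.
Fact transf_1mul : left_id transf_one transf_mul. Proof. by []. Qed.
Fact transf_mul1 : right_id transf_one transf_mul. Proof. by []. Qed.

HB.instance Definition _ :=
  isMonoid.Build (transf X) transf_mulA transf_1mul transf_mul1.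

End TransfMonoid.

Section Generation.
Variable G : semigroupType.
Implicit Types S A B : set G.

Definition subsemigroup S := forall x y, S x -> S y -> S (x * y)%g.

Definition generated A : set G := smallest subsemigroup A.

(* The cardinal rank(S : A) is the cardinality of the set K. *)
Definition relative_rank_is S A (U : Type) (K : set U) :=
  (exists B, [/\ B `<=` S, generated (A `|` B) = S & B #= K]) /\
  (forall B, B `<=` S -> generated (A `|` B) = S -> K #<= B).

End Generation.

Section OrientationPreserving.
Context {d : Order.disp_t} {X : orderType d}.
Implicit Types (f : transf X) (Y : set X).

Definition order_preserving f := {homo f : x y / x <= y}.

Definition orientation_preserving f :=
  exists X1 : set X, X1 !=set0 /\
    let X2 := ~` X1 in
    [/\ {in X1 &, {homo f : x y / x <= y}},
        {in X2 &, {homo f : x y / x <= y}} &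
        forall p q, X1 p -> X2 q -> p < q /\ f q <= f p].

Definition O_ Y : set (transf X) :=
  [set f | order_preserving f /\ range f `<=` Y].

Definition OP_ Y : set (transf X) :=
  [set f | orientation_preserving f /\ range f `<=` Y].

End OrientationPreserving.

(* Main.v *)
Require Import Defs.
From mathcomp Require Import all_boot all_order.
From mathcomp Require Import boolp classical_sets functions cardinality.

Local Open Scope classical_set_scope.

Import Order.TTheory.

(** Reversing the order changes neither semigroup, so [Y] may be assumed to have
a minimum [a]. Some orientation-preserving map is not order-preserving, so at
least one generator has to be added to [O_ Y]; a single one suffices.

Pick [a < c < e] in [Y] with [e] not maximal. The generator [r] is a rotation of
[Y]: it sends the interval from [a] to [c] onto the part of [Y] above [c] (without
its maximum), [c] to [a], the interval from [c] to [e] onto the interval from [a]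
to [c], and everything else to [c] ([exists_rotation]). The isomorphisms needed
come from the hypothesis on open convex sets.

If the image of [f] in [OP_ Y] is bounded above by a point of [Y], then [f] is a
product of [b], [r] and [s] with [b] and [s] in [O_ Y] ([OP_factor]): [b] embeds
the two parts of the cut of [f] into the two intervals exchanged by [r], and [s]
corrects the values. The bound is essential here: when [Y] is bounded in the
whole order but has no maximum, an order-preserving [s] into [Y] is bounded on
[Y] by a point of [Y], so [s] cannot produce an unbounded image. Hence if [Y]
has no maximum, [f] is first composed with a right inverse [q] of [r] on [Y].
The map [q] is again in [OP_ Y] and its values are at most [e], so the product
of [f] and [q] is covered by the bounded case, and multiplying by [r] gives [f]
back. It matters that [r] already covers [Y] with points below [e]: this is why
it is constant from [e] on instead of being injective. *)

(** * Orientation-preserving maps *)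

(** [P] is the first part of a cut along which [f] is orientation-preserving.
Unlike in [orientation_preserving], the first part may be empty. *)
Definition orientation_cut {d : Order.disp_t} {X : orderType d}
    (f : transf X) (P : X -> Prop) :=
  [/\ forall x y, P x -> P y -> (x <= y)%O -> (f x <= f y)%O,
      forall x y, ~ P x -> ~ P y -> (x <= y)%O -> (f x <= f y)%O &
      forall x y, P x -> ~ P y -> (x < y)%O /\ (f y <= f x)%O].

Section OrientationPreservingMaps.
Local Open Scope order_scope.
Context {d : Order.disp_t} {X : orderType d}.
Implicit Types (f g : transf X) (Y : set X).

Lemma orientation_preserving_cut {f} :
  orientation_preserving f -> exists P, orientation_cut f P.
Proof.
move=> [P [_ [hP hN hPN]]]; exists P; split=> // x y Px Py.
  by apply: hP; rewrite inE.
by apply: hN; rewrite inE.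
Qed.

(** If the first part of the cut is empty then [f] is order-preserving, so
the whole order can serve as the first part; it is nonempty thanks to [x0]. *)
Lemma cut_orientation_preserving (x0 : X) {f} {P : X -> Prop} :
  orientation_cut f P -> orientation_preserving f.
Proof.
move=> [hP hN hPN]; have [[p Pp]|P0] := pselect (exists p, P p).
  exists P; split; first by exists p.
  split=> // x y; rewrite !inE => Px Py; first exact: hP.
  exact: hN.
have notP x : ~ P x by move=> Px; apply: P0; exists x.
exists [set: X]; split; first by exists x0.
split=> [x y _ _|x y|x y _ /(_ I)//]; first exact: hN.
by rewrite !inE => /(_ I).
Qed.

Lemma order_preserving_orientation_preserving (x0 : X) {f} :
  order_preserving f -> orientation_preserving f.
Proof.
move=> hf; apply: (cut_orientation_preserving x0 (P := fun=> True)).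
by split=> [x y _ _|x y /(_ I)|x y _ /(_ I)] //; apply: hf.
Qed.

Lemma O_sub_OP {Y} : Y !=set0 -> O_ Y `<=` OP_ Y.
Proof.
move=> [y _] f [fO fY]; split=> //.
exact: (order_preserving_orientation_preserving y).
Qed.

(** Let [P] and [Q] be cuts for [f] and [g]. Points of [P] sent to [Q] and
points of [~ P] sent to [~ Q] cannot coexist, since [f] sends [~ P] below [P].
So the four classes cut out by [P] and [Q o f], consecutive in the order, are
at most three, and the composite has a cut at one end of the middle class. *)
Lemma orientation_preserving_mul (x0 : X) f g :
  orientation_preserving f -> orientation_preserving g ->
  orientation_preserving (f * g)%g.
Proof.
move=> /orientation_preserving_cut[P [fP fN fPN]].
move=> /orientation_preserving_cut[Q [gQ gN gQN]].
have mulE x : (f * g)%g x = g (f x) by [].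
have [[z [Pz Qz]]|noD] := pselect (exists z, ~ P z /\ ~ Q (f z)).
  have noA x : P x -> ~ Q (f x).
    move=> Px Qx; have [_ zx] := fPN _ _ Px Pz; have [xz _] := gQN _ _ Qx Qz.
    by move: (le_lt_trans zx xz); rewrite ltxx.
  apply: (cut_orientation_preserving x0 (P := fun x => P x \/ Q (f x))).
  split=> x y; rewrite !mulE.
  - case: (pselect (P x)) => [Px _|Px [//|Qx]].
      case: (pselect (P y)) => [Py _ xy|Py [//|Qy] _].
        by apply: gN; [exact: noA|exact: noA|exact: fP].
      exact: (gQN _ _ Qy (noA _ Px)).2.
    move=> [Py|Qy] xy; last first.
      apply: gQ => //; case: (pselect (P y)) => [Py|Py]; last exact: fN.
      by case: (noA _ Py Qy).
    by have := le_lt_trans xy (fPN _ _ Py Px).1; rewrite ltxx.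
  - move=> /not_orP[Px Qx] /not_orP[Py Qy] xy.
    by apply: gN => //; apply: fN.
  - move=> PQx /not_orP[Py Qy].
    case: (pselect (P x)) => [Px|Px].
      have [xy fyx] := fPN _ _ Px Py; split=> //.
      by apply: gN => //; apply: noA.
    case: PQx => [//|Qx]; have [fxy gyx] := gQN _ _ Qx Qy; split=> //.
    rewrite ltNge; apply/negP => yx.
    by have := lt_le_trans fxy (fN _ _ Py Px yx); rewrite ltxx.
have Qf x : ~ P x -> Q (f x).
  by move=> Px; apply: contrapT => Qx; apply: noD; exists x.
apply: (cut_orientation_preserving x0 (P := fun x => P x /\ Q (f x))).
split=> x y; rewrite !mulE.
- by move=> [Px Qx] [Py Qy] xy; apply: gQ => //; apply: fP.
- move=> PQx PQy xy.
  case: (pselect (P x)) => Px; case: (pselect (P y)) => Py.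
  + have Qx : ~ Q (f x) by move=> Qx; apply: PQx.
    have Qy : ~ Q (f y) by move=> Qy; apply: PQy.
    by apply: gN => //; apply: fP.
  + have Qx : ~ Q (f x) by move=> Qx; apply: PQx.
    exact: (gQN _ _ (Qf _ Py) Qx).2.
  + by have := le_lt_trans xy (fPN _ _ Py Px).1; rewrite ltxx.
  + by apply: gQ; [exact: Qf|exact: Qf|exact: fN].
- move=> [Px Qx] PQy; case: (pselect (P y)) => Py; last first.
    have [xy fyx] := fPN _ _ Px Py; split=> //.
    by apply: gQ => //; apply: Qf.
  have Qy : ~ Q (f y) by move=> Qy; apply: PQy.
  have [fxy gyx] := gQN _ _ Qx Qy; split=> //.
  rewrite ltNge; apply/negP => yx.
  by have := lt_le_trans fxy (fP _ _ Py Px yx); rewrite ltxx.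
Qed.

Lemma OP_subsemigroup {Y} : Y !=set0 -> subsemigroup (OP_ Y).
Proof.
move=> [y _] f g [fO _] [gO gY]; split.
  exact: orientation_preserving_mul.
by move=> _ [x _ <-]; apply: gY; exists (f x).
Qed.

Lemma O_subsemigroup {Y} : subsemigroup (O_ Y).
Proof.
move=> f g [fO _] [gO gY]; split.
  by move=> x y xy; apply/gO/fO.
by move=> _ [x _ <-]; apply: gY; exists (f x).
Qed.

(** The map that is [h1] before [c] and [h2] from [c] on. *)
Definition glue (c : X) (h1 h2 : transf X) : transf X :=
  fun x => if x < c then h1 x else h2 x.

Lemma glue_OP {Y} {c : X} {h1 h2 : transf X} :
  (forall x, x < c -> Y (h1 x)) -> (forall x, c <= x -> Y (h2 x)) ->
  (forall x y, x <= y -> y < c -> h1 x <= h1 y) ->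
  (forall x y, c <= x -> x <= y -> h2 x <= h2 y) ->
  (forall x y, x < c -> c <= y -> h2 y <= h1 x) ->
  OP_ Y (glue c h1 h2).
Proof.
move=> Y1 Y2 m1 m2 m21; split; last first.
  by move=> _ [x _ <-]; rewrite /glue; case: ltP => [/Y1|/Y2].
apply: (cut_orientation_preserving c (P := fun x => x < c)).
split=> x y; rewrite /glue.
- by move=> xc yc xy; rewrite xc yc; apply: m1.
- by move=> /negP; rewrite -leNgt => cx /negP; rewrite -leNgt => cy xy;
    rewrite !ltNge cx cy; apply: m2.
- move=> xc /negP; rewrite -leNgt => cy; split; first exact: lt_le_trans cy.
  by rewrite xc ltNge cy; apply: m21.
Qed.

(** * Suprema and order isomorphisms *)

(** The cut used separates the points strictly below some element of [A] from
the upper bounds of [A]; by density its first part has no maximum. *)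
Lemma exists_supremum :
  dense_order X -> cuts_filled X -> ~ has_min [set: X] ->
  forall (A : set X) (m : X), A !=set0 -> ubound A m ->
  exists s, ubound A s /\ lbound (ubound A) s.
Proof.
move=> dX cX nomin A m [a Aa] Am.
case: (cX [set x | exists2 y, A y & x < y] (ubound A)).
- apply/seteqP; split=> // x _ /=.
  have [|noy] := pselect (exists2 y, A y & x < y); first by left.
  right=> y Ay; rewrite leNgt; apply/negP => xy.
  by apply: noy; exists y.
- by move=> x y [z Az xz] /(_ z Az); apply: lt_le_trans.
- apply: contrapT => noxa; apply: nomin; exists a; split=> // x _.
  by rewrite leNgt; apply/negP => xa; apply: noxa; exists x; exists a.
- by exists m.
- move=> [x [[y Ay xy]]] xmax; have [z [xz zy]] := dX _ _ xy.
  have /xmax : (exists2 w, A w & z < w) by exists y.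
  by rewrite leNgt xz.
- by move=> [s [sub slb]]; exists s.
Qed.

(** [order_isomorphic] constrains its witness on [A] only, so the inverse [g] is
built by choice on [B] and is arbitrary elsewhere. *)
Lemma order_isomorphic_inv {A B : set X} :
  A !=set0 -> order_isomorphic A B -> exists f g : X -> X,
  [/\ (forall x, A x -> B (f x)) /\ (forall y, B y -> A (g y)),
      forall y, B y -> f (g y) = y,
      forall x y, A x -> A y -> x < y -> f x < f y &
      forall x y, B x -> B y -> x <= y -> g x <= g y].
Proof.
move=> [a Aa] [f [[fAB finj fsurj] fmono]].
pose g y := xget a [set x | A x /\ f x = y].
have gP y : B y -> A (g y) /\ f (g y) = y.
  by move=> /fsurj[x Ax fx]; rewrite /g; case: xgetP => [z _ //|/(_ x)[]].
have fsmono x y : A x -> A y -> x < y -> f x < f y.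
  move=> Ax Ay xy; rewrite lt_neqAle fmono ?inE ?ltW // andbT.
  by apply/eqP => /finj; rewrite !inE => /(_ Ax Ay) e; rewrite e ltxx in xy.
exists f, g; split=> //.
- by split=> [//|y /gP[]].
- by move=> y /gP[].
- move=> x y /gP[Ax fx] /gP[Ay fy] xy; rewrite leNgt; apply/negP.
  by move=> /(fsmono _ _ Ay Ax); rewrite fx fy ltNge xy.
Qed.

Lemma open_interval_convex (a b : X) : dense_order X -> a < b ->
  open_convex [set x | a < x /\ x < b].
Proof.
move=> dX /dX[x [ax xb]]; split.
- by exists x.
- move=> y z t [ay yb] [az zb] yt tz; split; first exact: lt_trans yt.
  exact: lt_trans zb.
- move=> [m [[am mb] mmax]]; have [y [my yb]] := dX _ _ mb.
  have /mmax : (a < y /\ y < b) by split=> //; apply: lt_trans my.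
  by rewrite leNgt my.
- move=> [m [[am mb] mmin]]; have [y [ay ym]] := dX _ _ am.
  have /mmin : (a < y /\ y < b) by split=> //; apply: lt_trans mb.
  by rewrite leNgt ym.
Qed.

(** For [Y] convex, this is the part of [Y] strictly above [c], deprived of
the maximum of [Y] if there is one. *)
Lemma open_upper_convex {Y} {c e z : X} : dense_order X -> convex Y ->
  Y c -> Y z -> c < e -> e < z ->
  open_convex [set x | c < x /\ exists2 t, Y t & x < t].
Proof.
move=> dX cY Yc Yz ce ez; split.
- by exists e; split=> //; exists z.
- move=> x y t [cx _] [cy [u Yu yu]] xt ty; split; first exact: lt_trans xt.
  by exists u => //; apply: lt_trans yu.
- move=> [m [[cm [t Yt mt]] mmax]]; have [y [my yt]] := dX _ _ mt.
  have /mmax : (c < y /\ exists2 t, Y t & y < t).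
    by split; [exact: lt_trans my|exists t].
  by rewrite leNgt my.
- move=> [m [[cm [t Yt mt]] mmin]]; have [y [cy ym]] := dX _ _ cm.
  have /mmin : (c < y /\ exists2 t, Y t & y < t).
    by split=> //; exists t => //; apply: lt_trans mt.
  by rewrite leNgt ym.
Qed.

(** * A rotation of the target *)

(** [r] is strictly increasing on the open interval from [a] to [c] and on the
one from [c] to [e], and puts the image of the second below that of the first. *)
Definition swaps_intervals (r : transf X) (a c e : X) :=
  [/\ forall x y, a < x -> x < y -> y < c -> r x < r y,
      forall x y, c < x -> x < y -> y < e -> r x < r y &
      forall x y, a < x -> x < c -> c < y -> y < e -> r y < r x].

(** The rotation [r] sends the open interval from [a] to [c] onto the part of
[Y] above [c] (minus a maximum), [c] to [a], and the open interval from [c] to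
[e] onto the one from [a] to [c]; elsewhere it is [c]. If [Y] has no maximum
then [r] sends [Y] onto [Y], and already does so on the points below [e], whence
the right inverse [q] bounded by [e]. *)
Lemma exists_rotation {Y} {a c e z : X} :
  dense_order X -> open_convex_isomorphic X -> convex Y ->
  Y a -> lbound Y a -> a < c -> c < e -> e < z -> Y z ->
  exists r, [/\ OP_ Y r, swaps_intervals r a c e &
    ~ has_max Y -> exists q,
      [/\ OP_ Y q, forall x, q x <= e & forall y, Y y -> r (q y) = y]].
Proof.
move=> dX iX cY Ya lba ac ce ez Yz.
have cz := lt_trans ce ez; have Yc : Y c by apply: (cY a z).
pose A1 := [set x | a < x /\ x < c].
pose A2 := [set x | c < x /\ x < e].
pose U := [set x | c < x /\ exists2 t, Y t & x < t].
have oA1 : open_convex A1 by exact: open_interval_convex.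
have oA2 : open_convex A2 by exact: open_interval_convex.
have oU : open_convex U by exact: (open_upper_convex dX cY Yc Yz ce ez).
have A1Y x : A1 x -> Y x by move=> [ax xc]; exact: (cY a c).
have A2Y x : A2 x -> Y x.
  by move=> [cx xe]; apply: (cY c z) => //; apply: lt_trans ez.
have UY x : U x -> Y x by move=> [cx [t Yt xt]]; exact: (cY c t).
have [nA1 _ _ _] := oA1; have [nA2 _ _ _] := oA2.
have [f1 [g1 [[f1U g1A] f1K f1m g1m]]] :=
  order_isomorphic_inv nA1 (iX _ _ oA1 oU).
have [f2 [g2 [[f2A g2A] f2K f2m g2m]]] :=
  order_isomorphic_inv nA2 (iX _ _ oA2 oA1).
exists (glue c (fun x => if x <= a then c else f1 x)
  (fun x => if x <= c then a else if x < e then f2 x else c)); split.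
- apply: glue_OP.
  + move=> x xc; case: (leP x a) => // ax; exact/UY/f1U.
  + move=> x cx; case: (leP x c) => // {}cx; case: (ltP x e) => // xe.
    exact/A1Y/f2A.
  + move=> x y xy yc; case: (leP y a) => [ya|ay].
      by rewrite (le_trans xy ya).
    case: (leP x a) => [_|ax]; first by apply/ltW/(f1U _ _).1.
    move: xy; rewrite le_eqVlt => /predU1P[->//|xy].
    by apply/ltW/f1m => //; split=> //; apply: lt_trans yc.
  + move=> x y cx xy; case: (leP x c) => [_|{}cx].
      case: ifP => // /negbT; rewrite -ltNge => cy.
      case: (ltP y e) => [ye|_]; last exact: ltW.
      by apply/ltW/(f2A y _).1.
    rewrite [y <= c]leNgt (lt_le_trans cx xy) /=; case: (ltP y e) => [ye|_].
      rewrite (le_lt_trans xy ye).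
      move: xy; rewrite le_eqVlt => /predU1P[->//|xy].
      apply/ltW/f2m => //; split=> //; first exact: lt_trans ye.
      exact: lt_trans xy.
    by case: (ltP x e) => // xe; apply/ltW/(f2A x _).2.
  + move=> x y xc cy; apply: (@le_trans _ _ c).
      case: (leP y c) => [_|{}cy]; first exact: ltW.
      by case: (ltP y e) => // ye; apply/ltW/(f2A y _).2.
    by case: (leP x a) => // ax; apply/ltW/(f1U x _).1.
- split=> x y; rewrite /glue.
  + move=> ax xy yc; have xc := lt_trans xy yc; have ay := lt_trans ax xy.
    by rewrite xc yc !leNgt ax ay /=; apply: f1m.
  + move=> cx xy ye; have xe := lt_trans xy ye; have cy := lt_trans cx xy.
    rewrite [x < c]ltNge [y < c]ltNge (ltW cx) (ltW cy) /=.
    by rewrite [x <= c]leNgt [y <= c]leNgt cx cy xe ye; apply: f2m.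
  + move=> ax xc cy ye.
    rewrite xc [y < c]ltNge (ltW cy) !leNgt ax cy ye /=.
    apply: (@lt_trans _ _ c); first by apply: (f2A y _).2.
    by apply: (f1U x _).1.
move=> Ynomax.
have YU y : Y y -> c < y -> U y.
  move=> Yy cy; split=> //; apply: contrapT => noY; apply: Ynomax.
  exists y; split=> // t Yt; rewrite leNgt; apply/negP => yt.
  by apply: noY; exists t.
have inU x y : c < x -> x <= y -> U y -> U x.
  move=> cx xy [_ [t Yt yt]]; split=> //; exists t => //.
  exact: le_lt_trans yt.
pose q := glue c (fun y => if y <= a then c else g2 y)
  (fun y => if y <= c then a else if `[< U y >] then g1 y else c).
exists q; split.
- apply: glue_OP.
  + move=> x xc; case: (leP x a) => // ax; exact/A2Y/g2A.
  + move=> x cx; case: (leP x c) => // {}cx; case: asboolP => // Ux.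
    exact/A1Y/g1A.
  + move=> x y xy yc; case: (leP y a) => [ya|ay].
      by rewrite (le_trans xy ya).
    case: (leP x a) => [_|ax]; first by apply/ltW/(g2A _ _).1.
    by apply: g2m => //; split=> //; apply: le_lt_trans yc.
  + move=> x y cx xy; case: (leP x c) => [_|{}cx].
      case: ifP => // /negbT; rewrite -ltNge => cy.
      case: asboolP => [Uy|_]; last exact: ltW.
      by apply/ltW/(g1A y _).1.
    rewrite [y <= c]leNgt (lt_le_trans cx xy) /=; case: asboolP => [Ux|nUx].
      case: asboolP => [Uy|_]; first exact: g1m.
      by apply/ltW/(g1A x _).2.
    by case: asboolP => // /(inU _ _ cx xy).
  + move=> x y xc cy; apply: (@le_trans _ _ c).
      case: (leP y c) => [_|{}cy]; first exact: ltW.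
      by case: asboolP => // Uy; apply/ltW/(g1A y _).2.
    by case: (leP x a) => // ax; apply/ltW/(g2A x _).1.
- move=> x; rewrite /q /glue; case: ltP => xc.
    case: (leP x a) => ax; first exact: ltW.
    by apply/ltW/(g2A x _).2.
  case: (leP x c) => _; first exact/ltW/(lt_trans ac ce).
  case: asboolP => [Ux|_]; last exact: ltW.
  exact/ltW/(lt_trans (g1A x Ux).2 ce).
- move=> y Yy; rewrite /q /glue; case: (ltP y c) => yc.
    case: (leP y a) => [ya|ay].
      rewrite ltxx lexx; apply/eqP; rewrite eq_le ya andbT; exact: lba.
    have [cg ge] := g2A y (conj ay yc).
    by rewrite ltNge (ltW cg) /= leNgt cg ge /= f2K.
  case: (leP y c) => [cy|cy].
    by rewrite ac lexx; apply/eqP; rewrite eq_le yc cy.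
  have Uy := YU _ Yy cy; rewrite asboolT //.
  by have [ag gc] := g1A y Uy; rewrite gc leNgt ag /= f1K.
Qed.

(** Any [f] in [OP_ Y] with image bounded in [Y] is [b], then [r], then [s].
Take [b] to send the first part of the cut of [f] into the interval from [a] to
[c] and the second part into the one from [c] to [e]: then [b] followed by [r]
orders all points at least as finely as [f] does, and [s] is defined by
suprema. *)
Lemma OP_factor {Y} {a c e m : X} {r f : transf X} :
  dense_order X -> cuts_filled X -> open_convex_isomorphic X ->
  ~ has_max [set: X] -> ~ has_min [set: X] -> convex Y ->
  Y a -> lbound Y a -> a < c -> c < e -> Y e -> swaps_intervals r a c e ->
  OP_ Y f -> Y m -> (forall x, f x <= m) ->
  exists b s, [/\ O_ Y b, O_ Y s & f = (b * r * s)%g].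
Proof.
move=> dX cX iX nomax nomin cY Ya lba ac ce Ye [r1 r2 r21] [fOP fY] Ym fm.
have [P [fP fN fPN]] := orientation_preserving_cut fOP.
have oX : open_convex [set: X] by split=> //; exists a.
have nX : [set: X] !=set0 by exists a.
have ae := lt_trans ac ce.
have [h [_ [[h1 _] _ hm _]]] :=
  order_isomorphic_inv nX (iX _ _ oX (open_interval_convex a c dX ac)).
have [k [_ [[k2 _] _ km _]]] :=
  order_isomorphic_inv nX (iX _ _ oX (open_interval_convex c e dX ce)).
pose b : transf X := fun x => if `[< P x >] then h x else k x.
have bO : O_ Y b.
  split; last first.
    move=> _ [x _ <-]; rewrite /b; case: ifP => _.
      have [? ?] := h1 x I; apply: (cY a e) => //; exact: lt_trans ce.
    have [? ?] := k2 x I; apply: (cY a e) => //; exact: lt_trans ac _.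
  move=> x y; rewrite le_eqVlt => /predU1P[->//|xy]; rewrite /b.
  case: asboolP => Px; case: asboolP => Py; apply/ltW.
  - exact: hm.
  - exact: lt_trans (h1 x I).2 (k2 y I).1.
  - by have := lt_trans (fPN _ _ Py Px).1 xy; rewrite ltxx.
  - exact: km.
(* [b] followed by [r] reverses the two parts of the cut, just as [f] does *)
have brf x y : r (b x) <= r (b y) -> f x <= f y.
  move=> le_xy; rewrite /b in le_xy; move: le_xy.
  case: asboolP => Px; case: asboolP => Py le_xy.
  - apply: fP => //; rewrite leNgt; apply/negP => yx.
    move: le_xy; rewrite leNgt r1 ?hm //; first exact: (h1 y I).1.
    exact: (h1 x I).2.
  - have [? ?] := h1 x I; have [? ?] := k2 y I.
    by move: le_xy; rewrite leNgt r21.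
  - exact: (fPN _ _ Py Px).2.
  - apply: fN => //; rewrite leNgt; apply/negP => yx.
    move: le_xy; rewrite leNgt r2 ?km //; first exact: (k2 y I).1.
    exact: (k2 x I).2.
(* [a] is put in the set so that it is nonempty, below the image of [b * r] *)
pose below y := [set v | v = a \/ exists2 x, r (b x) <= y & v = f x].
have belowm y : ubound (below y) m.
  by move=> v [->|[x _ ->]]; [exact: lba|exact: fm].
have /choice[s sP] y : exists s, ubound (below y) s /\ lbound (ubound (below y)) s.
  by apply: (exists_supremum dX cX nomin _ m) => //; exists a; left.
exists b, s; split=> //.
  split.
    move=> x y xy; apply: (sP x).2 => v [->|[t rx ->]]; apply: (sP y).1.
      by left.
    by right; exists t => //; apply: le_trans xy.
  move=> _ [x _ <-]; have sxm : s x <= m := (sP x).2 m (belowm x).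
  have asx : a <= s x by apply: (sP x).1; left.
  have [<-//|a_neq] := eqVneq a (s x); have [->//|m_neq] := eqVneq (s x) m.
  by apply: (cY a m); rewrite // lt_neqAle ?a_neq ?m_neq.
apply/funext => x; change (f x = s (r (b x))); apply/eqP.
rewrite eq_le; apply/andP; split; first by apply: (sP _).1; right; exists x.
apply: (sP _).2 => v [->|[t /brf tx ->]] //.
by apply: lba; apply: fY; exists x.
Qed.

(** * The relative rank *)

Lemma relative_rank_min {Y} :
  dense_order X -> cuts_filled X -> open_convex_isomorphic X ->
  ~ has_max [set: X] -> ~ has_min [set: X] -> convex Y -> ~ is_subset1 Y ->
  has_min Y -> relative_rank_is (OP_ Y) (O_ Y) `I_1.
Proof.
move=> dX cX iX nomax nomin cY Y2 [a [Ya lba]].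
have [z [Yz az]] : exists z, Y z /\ a < z.
  apply: contrapT => noz; apply: Y2 => x y Yx Yy.
  have Ya_eq t : Y t -> t = a.
    move=> Yt; apply/eqP; rewrite eq_le lba // andbT leNgt; apply/negP => at_.
    by apply: noz; exists t.
  by rewrite (Ya_eq _ Yx) (Ya_eq _ Yy).
have [e [ae ez]] := dX _ _ az; have [c [ac ce]] := dX _ _ ae.
have Ye : Y e by apply: (cY a z).
have Y0 : Y !=set0 by exists a.
have [r [rOP rswap rinv]] := exists_rotation dX iX cY Ya lba ac ce ez Yz.
have rnO : ~ O_ Y r.
  move=> [rO _]; have [x [ax xc]] := dX _ _ ac; have [y [cy ye]] := dX _ _ ce.
  have [_ _ /(_ x y ax xc cy ye)] := rswap.
  by rewrite ltNge rO // ltW // (lt_trans xc cy).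
split.
  exists [set r]; split; [by move=> _ ->| |exact: card_set1].
  have OrOP : O_ Y `|` [set r] `<=` OP_ Y.
    by move=> f [/(O_sub_OP Y0)//|->].
  apply/seteqP; split; first exact: smallest_sub (OP_subsemigroup Y0) OrOP.
  move=> f fOP M [Msub Mgen].
  have Mr : M r by apply: Mgen; right.
  have bounded g m : OP_ Y g -> Y m -> (forall x, g x <= m) -> M g.
    move=> gOP Ym gm.
    have [b [s [bO sO ->]]] :=
      OP_factor dX cX iX nomax nomin cY Ya lba ac ce Ye rswap gOP Ym gm.
    by apply: (Msub); [apply: (Msub) => //|]; apply: Mgen; left.
  have [[m [Ym mub]]|Ynomax] := pselect (has_max Y).
    by apply: (bounded f m) => // x; apply: mub; apply: fOP.2; exists x.
  (* without a maximum, [q] moves the image of [f] below [e], and [r] undoes it *)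
  have [q [qOP qe rq]] := rinv Ynomax.
  have -> : f = (f * q * r)%g.
    by apply/funext => x; rewrite -[LHS]rq //; apply: fOP.2; exists x.
  apply: Msub => //; apply: (bounded _ e) => //.
    exact: (OP_subsemigroup Y0).
  by move=> x; exact: qe.
move=> B BOP Bgen; have [[b Bb]|B0] := pselect (B !=set0).
  rewrite -(card_le_eql (@card_set1 _ b)).
  by apply: subset_card_le => _ ->.
exfalso; apply: rnO.
have BE : B = set0 by apply: contrapT => /eqP/set0P.
by move: rOP; rewrite -Bgen BE setU0 /generated (smallest_id O_subsemigroup).
Qed.

End OrientationPreservingMaps.

(** * Reversing the order *)

Section Reversal.
Context {d : Order.disp_t} {X : orderType d}.

(** Reversing the order exchanges the two parts of a cut. *)
Lemma orientation_preserving_dual (f : transf X) :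
  @orientation_preserving _ X^d f <-> orientation_preserving f.
Proof.
split=> fOP; have [_ [[x0 _] _]] := fOP;
  have [P [fP fN fPN]] := orientation_preserving_cut fOP.
- apply: (cut_orientation_preserving (x0 : X) (P := fun x => ~ P x)).
  split=> x y.
  + by move=> Px Py xy; apply: fN.
  + by move=> /contrapT Px /contrapT Py xy; apply: fP.
  + by move=> Px /contrapT Py; apply: fPN.
- apply: (cut_orientation_preserving (x0 : X^d) (P := fun x => ~ P x)).
  split=> x y.
  + by move=> Px Py xy; apply: fN.
  + by move=> /contrapT Px /contrapT Py xy; apply: fP.
  + by move=> Px /contrapT Py; apply: fPN.
Qed.

Lemma OP_dual (Y : set X) : @OP_ _ X^d Y = OP_ Y.
Proof.
by apply/seteqP; split=> f [/orientation_preserving_dual fOP fY].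
Qed.

Lemma O_dual (Y : set X) : @O_ _ X^d Y = O_ Y.
Proof. by apply/seteqP; split=> f [fO fY]; split=> // x y; apply: fO. Qed.

Lemma dense_order_dual : dense_order X -> dense_order X^d.
Proof. by move=> dX x y /dX[z [yz zx]]; exists z; split. Qed.

Lemma cuts_filled_dual : cuts_filled X -> cuts_filled X^d.
Proof.
move=> cX A B AB ltAB A0 B0.
case: (cX B A) => //; [by rewrite setUC| |by right|by left].
by move=> b a Bb Aa; exact: ltAB.
Qed.

Lemma convex_dual (C : set X) : @convex _ X^d C <-> convex C.
Proof. by split=> cC x y z Cx Cy xz zy; apply: (cC y x z). Qed.

Lemma open_convex_isomorphic_dual :
  open_convex_isomorphic X -> open_convex_isomorphic X^d.
Proof.
have oc (A : set X) : @open_convex _ X^d A -> open_convex A.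
  by move=> [A0 /convex_dual cA noM nom].
move=> iX A B /oc oA /oc oB; have [f [fAB fm]] := iX _ _ oA oB.
by exists f; split=> // x y Ax Ay; apply: fm.
Qed.

End Reversal.

Theorem theorem10 (d : Order.disp_t) (X : orderType d)
    (X_infinite : infinite_set [set: X])
    (X_dense : dense_order X)
    (X_cuts : cuts_filled X)
    (X_iso : open_convex_isomorphic X)
    (X_nomax : ~ has_max [set: X])
    (X_nomin : ~ has_min [set: X])
    (Y : set X)
    (Y_nonempty : Y !=set0)
    (Y_proper : Y `<` [set: X])
    (Y_convex : convex Y)
    (Y_nontrivial : ~ is_subset1 Y)
    (Y_end : has_min Y \/ has_max Y) :
  relative_rank_is (OP_ Y) (O_ Y) `I_1.
Proof.
case: Y_end => [Ymin|Ymax]; first exact: relative_rank_min.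
rewrite -OP_dual -O_dual; apply: (relative_rank_min (X := X^d)) => //.
- exact: dense_order_dual.
- exact: cuts_filled_dual.
- exact: open_convex_isomorphic_dual.
- exact/convex_dual.
Qed.
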